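(* Let two Buck converters be connected in series (cascaded) along a line, each driving a constant power load, where all connecting lines have the same resistance $R$. Let $L_k,C_k,P_k,\bar V_k>0$ and $D_k\in(0,1)$, $k=1,2$, be the fixed parameters of the converters, and let the small-signal closed-loop network matrix $\tilde{\mathbf A}(R)=\mathbf A(R)+\mathbf B\mathbf F$ be as defined in the context. Then for all linear state feedback controllers $\mathbf F=\begin{bmatrix}\mathbf F_1&0\\0&\mathbf F_2\end{bmatrix}$, with $\mathbf F_1,\mathbf F_2\in\mathbb R^{1\times 2}$ (each converter only uses its own states), such that each converter $k\in\{1,2\}$ is individually stabilized by $\mathbf F_k$, there exist values of $R>0$ for which the network is not stable, i.e. for which $\tilde{\mathbf A}(R)$ is not Hurwitz.
   Context: A real square matrix is called stable (Hurwitz) if all its eigenvalues have strictly negative real part; a linear system $\dot{\mathbf x}=\mathbf M\mathbf x$ is stable if $\mathbf M$ is Hurwitz. Network: a DC source feeds, through a line of resistance $R$, the input node of converter 1; a further line of resistance $R$ connects the input node of converter 1 to the input node of converter 2. Converter $k$ has inductance $L_k>0$, capacitance $C_k>0$, nominal duty cycle $D_k\in(0,1)$, steady-state average output voltage $\bar V_k>0$, and drives a constant power load of power $P_k>0$ (the load draws current $P_k/V_k$ at voltage $V_k$). These parameters are treated as fixed constants independent of $R$. Stability is understood for the averaged, linearized (small-signal) model $\dot{\mathbf x}=\mathbf A(R)\mathbf x+\mathbf B\mathbf u$ with state $\mathbf x=(i_1,v_1,i_2,v_2)^T$ ($i_k$ is the small-signal inductor current and $v_k$ the small-signal capacitor voltage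 of converter $k$), input $\mathbf u=(d_1,d_2)^T$ (small-signal duty cycles), and $$\mathbf A(R)=\begin{bmatrix} -\frac{D_1R}{L_1} & -\frac1{L_1} & -\frac{D_1R}{L_1} & 0\\ \frac1{C_1} & \frac{P_1}{C_1\bar V_1^2} & 0&0\\ -\frac{D_2R}{L_2} & 0 & -\frac{2D_2R}{L_2} & -\frac1{L_2}\\ 0&0&\frac1{C_2}&\frac{P_2}{C_2\bar V_2^2}\end{bmatrix},\qquad \mathbf B=\begin{bmatrix}\mathbf B_1&0\\0&\mathbf B_2\end{bmatrix},\quad \mathbf B_k=\begin{bmatrix}\bar V_k/L_k\\0\end{bmatrix}.$$ Linear state feedback means $\mathbf u=\mathbf F\mathbf x$ with $\mathbf F$ a constant matrix (not depending on $R$), so the closed-loop matrix is $\tilde{\mathbf A}(R)=\mathbf A(R)+\mathbf B\mathbf F$. Converter $k$ is individually stabilized by $\mathbf F_k$ if it is stable as a standalone circuit connecting a power source directly to its constant power load, i.e. if $$\begin{bmatrix}0&-\frac1{L_k}\\ \frac1{C_k}&\frac{P_k}{C_k\bar V_k^2}\end{bmatrix}+\mathbf B_k\mathbf F_k$$ is Hurwitz. *)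

(* Defs.v *)
From HB Require Import structures.
From mathcomp Require Import all_boot all_order all_algebra.
From mathcomp Require Import complex reals.
Set Implicit Arguments.
Unset Strict Implicit.
Unset Printing Implicit Defensive.
Import Order.TTheory GRing.Theory Num.Theory.
Local Open Scope ring_scope.

Definition hurwitz (K : realType) (n : nat) (A : 'M[K]_n) : Prop :=
  forall z : K[i], eigenvalue (map_mx (real_complex K) A) z -> complex.Re z < 0.

(* Missing entries are read as 0. *)
Definition mx_of_rows (K : realType) (m n : nat) (s : seq (seq K)) : 'M[K]_(m, n) :=
  \matrix_(i, j) nth 0 (nth [::] s i) j.

Record converter (K : realType) := Converter {
  inductance : K;
  capacitance : K;
  duty : K;     (* nominal duty cycle *)
  voltage : K;  (* steady-state average output voltage *)
  power : K     (* power of the constant power load *)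
}.

Definition admissible (K : realType) (c : converter K) : Prop :=
  [/\ 0 < inductance c, 0 < capacitance c, 0 < duty c < 1,
      0 < voltage c & 0 < power c].

Definition standalone_A (K : realType) (c : converter K) : 'M[K]_2 :=
  let: Converter L C _ V P := c in
  mx_of_rows 2 2 [:: [:: 0; - (1 / L)];
                     [:: 1 / C; P / (C * V ^+ 2)]].

Definition input_B (K : realType) (c : converter K) : 'M[K]_(2, 1) :=
  let: Converter L _ _ V _ := c in
  mx_of_rows 2 1 [:: [:: V / L]; [:: 0]].

Definition individually_stabilized (K : realType) (c : converter K)
    (F : 'M[K]_(1, 2)) : Prop :=
  hurwitz (standalone_A c + input_B c *m F).

(* Averaged small-signal model of the cascade, in the state (i1, v1, i2, v2).
   Converter 2 sees the line segment to the source in series with its own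
   segment, whence the factor 2 in the (i2, i2) entry.  The dimension is written
   2 + 2 so that the matrix can be added to products of block matrices. *)
Definition network_A (K : realType) (c1 c2 : converter K) (r : K) :
    'M[K]_(2 + 2) :=
  let: Converter L1 C1 D1 V1 P1 := c1 in
  let: Converter L2 C2 D2 V2 P2 := c2 in
  mx_of_rows (2 + 2) (2 + 2)
    [:: [:: - (D1 * r / L1); - (1 / L1); - (D1 * r / L1); 0];
        [:: 1 / C1; P1 / (C1 * V1 ^+ 2); 0; 0];
        [:: - (D2 * r / L2); 0; - (2 * D2 * r / L2); - (1 / L2)];
        [:: 0; 0; 1 / C2; P2 / (C2 * V2 ^+ 2)]].

Definition network_B (K : realType) (c1 c2 : converter K) :
    'M[K]_(2 + 2, 1 + 1) :=
  block_mx (input_B c1) 0 0 (input_B c2).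

Definition closed_loop (K : realType) (c1 c2 : converter K)
    (F : 'M[K]_(1 + 1, 2 + 2)) (r : K) : 'M[K]_(2 + 2) :=
  network_A c1 c2 r + network_B c1 c2 *m F.

(* Main.v *)
Require Import Defs.
From HB Require Import structures.
From mathcomp Require Import all_boot all_order all_algebra.
From mathcomp Require Import complex reals.
From mathcomp Require Import ring lra.
Set Implicit Arguments.
Unset Strict Implicit.
Unset Printing Implicit Defensive.
Import Order.TTheory GRing.Theory Num.Theory.
Local Open Scope ring_scope.

(** The two lowest coefficients of the characteristic polynomial of a Hurwitz
    matrix have the same strict sign; the proof shows that a large line
    resistance forces opposite signs.

    The sign condition comes from the logarithmic derivative at 0: for a real
    polynomial p with roots z_i, the quotient p'(0) / p(0) is the sum of the
    - 1 / z_i, and each term has positive real part when Re z_i < 0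
    ([low_coefs_same_sign]).

    For the network, write A and B for the closed-loop matrices of the two
    standalone converters, p_1 and p_2 for their lower right entries, and
    x = D_1 / L_1, y = D_2 / L_2.  State feedback acts only through the inductor
    rows, so p_k = P_k / (C_k V_k^2) > 0 for every choice of F_1, F_2.  The line
    resistance enters only the entries that couple inductor currents, and the
    characteristic polynomial of the network is ([char_poly_cascade])
      (chi_A + x r (X - p_1)) (chi_B + 2 y r (X - p_2))
        - x y r^2 (X - p_1) (X - p_2).
    Its r^2 part is x y (X - p_1) (X - p_2), whose constant coefficient
    x y p_1 p_2 is positive and whose linear coefficient - x y (p_1 + p_2) is
    negative.  For r large the r^2 parts decide the signs
    ([cascade_not_hurwitz]).  Intuitively, a large resistance forces the
    inductor currents to 0 and leaves v_k' = p_k v_k, so that two eigenvalues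
    tend to p_1 and p_2. *)

(** * A necessary condition for stability *)

Lemma coef1M (R : nzSemiRingType) (p q : {poly R}) :
  (p * q)`_1 = p`_0 * q`_1 + p`_1 * q`_0.
Proof. by rewrite coefM !big_ord_recl big_ord0 addr0. Qed.

Lemma Re_inv_lt0 (K : rcfType) (z : K[i]) :
  complex.Re z < 0 -> complex.Re z^-1 < 0.
Proof.
case: z => a b /= a0; rewrite pmulr_llt0 // invr_gt0.
by rewrite ltr_wpDr ?sqr_ge0 // exprn_even_gt0 //= ltr0_neq0.
Qed.

(** The logarithmic derivative at 0 of a product of linear factors, phrased with
    coefficients: multiplying P by X - z adds - 1 / z to P`_1 / P`_0. *)
Lemma Re_coef1_div_coef0 (K : rcfType) (s : seq K[i]) :
    (forall z, z \in s -> complex.Re z < 0) ->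
  let P := \prod_(z <- s) ('X - z%:P) in
  P`_0 != 0 /\
  if s is [::] then P`_1 = 0 else 0 < complex.Re (P`_1 / P`_0).
Proof.
elim: s => [|z s IHs] sP /=; first by rewrite big_nil !coef1 oner_neq0.
have [|P0 P1] := IHs; first by move=> y ys; apply: sP; rewrite inE ys orbT.
have z_lt0 : complex.Re z < 0 by apply: sP; rewrite mem_head.
have z0 : z != 0 by apply: contraTneq z_lt0 => ->; rewrite ltxx.
rewrite big_cons; set P := \prod_(_ <- s) _ in P0 P1 *.
rewrite coef1M coef0M !coefB !coefX !coefC /= sub0r subr0 mul1r.
split; first by rewrite mulf_neq0 // oppr_eq0.
have -> : (- z * P`_1 + P`_0) / (- z * P`_0) = P`_1 / P`_0 - z^-1.
  by field; rewrite z0.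
rewrite raddfB /= subr_gt0 (lt_le_trans (Re_inv_lt0 z_lt0)) //.
by case: s {IHs sP} @P P0 P1 => [|y s] P P0 P1; [rewrite P1 mul0r|apply: ltW].
Qed.

(** Since p is real, p`_1 / p`_0 equals its own real part, which is positive by
    the factored form over the complex numbers. *)
Lemma low_coefs_same_sign (K : rcfType) (p : {poly K}) :
    (1 < size p)%N ->
    (forall z : K[i], root (map_poly (real_complex K) p) z ->
       complex.Re z < 0) ->
  0 < p`_0 * p`_1.
Proof.
move=> p_gt1 pP; set q := map_poly _ p in pP.
have sq : size q = size p by rewrite size_map_poly.
have q0 : q != 0 by rewrite -size_poly_gt0 sq (ltn_trans _ p_gt1).
have [s qE] := closed_field_poly_normal q.
have lq : lead_coef q != 0 by rewrite lead_coef_eq0.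
have sP z : z \in s -> complex.Re z < 0.
  by move=> zs; apply: pP; rewrite qE rootZ // root_prod_XsubC.
have [P0 P1] := Re_coef1_div_coef0 sP.
have {P1} P1 : 0 < complex.Re (q`_1 / q`_0).
  rewrite qE !coefZ -mulf_div divff // mul1r.
  case: s P1 {P0 sP} qE => [|//] _ qE; move: p_gt1; rewrite -sq qE.
  by rewrite big_nil size_scale // size_poly1.
have p0 : p`_0 != 0.
  have : q`_0 != 0 by rewrite qE coefZ mulf_neq0.
  by rewrite coef_map fmorph_eq0.
move: P1; rewrite !coef_map -fmorph_div /= => P1.
have -> : p`_0 * p`_1 = p`_0 ^+ 2 * (p`_1 / p`_0) by field.
by rewrite mulr_gt0 // exprn_even_gt0.
Qed.

Lemma hurwitz_low_coefs (K : realType) (n : nat) (A : 'M[K]_n.+1) :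
  hurwitz A -> 0 < (char_poly A)`_0 * (char_poly A)`_1.
Proof.
move=> hA; apply: low_coefs_same_sign; first by rewrite size_char_poly.
by move=> z; rewrite map_char_poly -eigenvalue_root_char; apply: hA.
Qed.

(** * The characteristic polynomial of the cascade *)

Lemma det_mx22 (R : comNzRingType) (A : 'M[R]_2) :
  \det A = A 0 0 * A 1 1 - A 0 1 * A 1 0.
Proof.
rewrite (expand_det_row _ 0) !big_ord_recl big_ord0 /cofactor !det_mx11 !mxE /=.
have -> : lift 0 0 = 1 :> 'I_2 by apply/val_inj.
have -> : lift 1 0 = 0 :> 'I_2 by apply/val_inj.
by rewrite /bump /=; ring.
Qed.

(** With coupling only between the first coordinates of the two blocks, the
    Laplace expansion has a single mixed term, in which both blocks lose their
    first row and column. *)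
Lemma det_block_delta (R : comNzRingType) (A B : 'M[R]_2) (u v : R) :
  \det (block_mx A (u *: delta_mx 0 0) (v *: delta_mx 0 0) B) =
  \det A * \det B - u * v * (A 1 1 * B 1 1).
Proof.
pose rows := [:: [:: A 0 0; A 0 1; u; 0]; [:: A 1 0; A 1 1; 0; 0];
                 [:: v; 0; B 0 0; B 0 1]; [:: 0; 0; B 1 0; B 1 1]].
have -> : block_mx A (u *: delta_mx 0 0) (v *: delta_mx 0 0) B =
    \matrix_(i, j) nth 0 (nth [::] rows i) j.
  apply/matrixP => i j; rewrite !mxE.
  by case: splitP => -[[|[|k]] // lt_k] ->; rewrite !mxE;
    case: splitP => -[[|[|l]] // lt_l] ->; rewrite ?mxE /= ?mulr1 ?mulr0 //;
    congr (_ _ _); apply: val_inj.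
rewrite !det_mx22 (expand_det_row _ 0) !big_ord_recl big_ord0 /cofactor.
rewrite !(expand_det_row _ 0) !big_ord_recl !big_ord0 /cofactor !det_mx22.
by rewrite !mxE /= /bump /= ; ring.
Qed.

Lemma det_add_delta (R : comNzRingType) (A : 'M[R]_2) (u : R) :
  \det (A + u *: delta_mx 0 0) = \det A + u * A 1 1.
Proof. by rewrite !det_mx22 !mxE /=; ring. Qed.

(** The first coordinate of each block is an inductor current; x and y are the
    line resistance times the ratio duty / inductance of the two converters. *)
Definition cascade_mx (R : pzRingType) (A B : 'M[R]_2) (x y : R) :=
  block_mx (A - x *: delta_mx 0 0) (- x *: delta_mx 0 0)
           (- y *: delta_mx 0 0) (B - (2 * y) *: delta_mx 0 0).

Lemma char_poly_cascade (R : comNzRingType) (A B : 'M[R]_2) (x y : R) :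
  char_poly (cascade_mx A B x y) =
  (char_poly A + x%:P * ('X - (A 1 1)%:P)) *
  (char_poly B + (2 * y)%:P * ('X - (B 1 1)%:P)) -
  x%:P * y%:P * (('X - (A 1 1)%:P) * ('X - (B 1 1)%:P)).
Proof.
have E (z : R) (M : 'M[R]_2) :
    char_poly_mx (M - z *: delta_mx 0 0) =
    char_poly_mx M + z%:P *: delta_mx 0 0.
  by rewrite /char_poly_mx raddfB /= map_mxZ map_delta_mx opprD opprK addrA.
have -> : char_poly (cascade_mx A B x y) =
    \det (block_mx (char_poly_mx (A - x *: delta_mx 0 0))
            (x%:P *: delta_mx 0 0) (y%:P *: delta_mx 0 0)
            (char_poly_mx (B - (2 * y) *: delta_mx 0 0))).
  rewrite /char_poly /char_poly_mx map_block_mx !map_mxZ !map_delta_mx.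
  rewrite (scalar_mx_block 2 2) opp_block_mx add_block_mx !add0r /=.
  by rewrite !rmorphN /= !scaleNr !opprK.
rewrite det_block_delta !E !det_add_delta.
by rewrite !mxE /= !mulr0 !addr0 !mulr1n.
Qed.

(** * Large line resistance *)

Lemma quadratic_eventually_gt0 (K : realFieldType) (a b c : K) :
  0 < a -> exists2 r0, 0 < r0 & forall r, r0 <= r -> 0 < a * r ^+ 2 + b * r + c.
Proof.
move=> a0; exists (1 + (`|b| + `|c|) / a).
  by rewrite ltr_wpDr // divr_ge0 ?addr_ge0 // ltW.
move=> r; rewrite -lerBrDl ler_pdivrMr // => r_ge.
have r1 : 1 <= r.
  by rewrite -subr_ge0 -(pmulr_lge0 _ a0) (le_trans _ r_ge) ?addr_ge0.
have r0 : 0 < r by rewrite (lt_le_trans ltr01).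
have rb : 0 <= (`|b| + b) * r.
  by rewrite mulr_ge0 ?(ltW r0) // -[b in _ + b]opprK subr_ge0 -normrN ler_norm.
have rc : 0 <= `|c| * (r - 1) by rewrite mulr_ge0 // subr_ge0.
have c0 : - c <= `|c| by rewrite -normrN ler_norm.
have ar : 0 < a * r by rewrite mulr_gt0.
have := ler_wpM2r (ltW r0) r_ge.
lra.
Qed.

(** The constant and linear coefficients are quadratic in r, with leading
    coefficients x y p q > 0 and - x y (p + q) < 0, where p = A 1 1 and
    q = B 1 1; past the larger of two thresholds their product is negative. *)
Lemma cascade_not_hurwitz (K : realType) (A B : 'M[K]_2) (x y : K) :
    0 < x -> 0 < y -> 0 < A 1 1 -> 0 < B 1 1 ->
  exists2 r, 0 < r & ~ hurwitz (cascade_mx A B (x * r) (y * r)).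
Proof.
move=> x0 y0; set p := A 1 1; set q := B 1 1 => p0 q0.
pose s := (char_poly A)`_1; pose t := (char_poly B)`_1.
pose d := (char_poly A)`_0; pose e := (char_poly B)`_0.
(* The constant coefficient of the characteristic polynomial at r. *)
have [r1 _ r1P] := @quadratic_eventually_gt0 K (x * y * (p * q))
   (- (x * p * e + 2 * y * q * d)) (d * e)
   ltac:(by rewrite !mulr_gt0).
(* The opposite of its linear coefficient. *)
have [r2 r20 r2P] := @quadratic_eventually_gt0 K (x * y * (p + q))
   (- (x * (e - p * t) + 2 * y * (d - q * s))) (- (d * t + s * e))
   ltac:(by rewrite !mulr_gt0 ?addr_gt0).
have {r1P} := r1P (Num.max r1 r2); have {r2P} := r2P (Num.max r1 r2).
rewrite !le_max !lexx orbT /=; set r := Num.max r1 r2.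
move=> /(_ isT) N1 /(_ isT) N0.
exists r; first by rewrite lt_max r20 orbT.
move/hurwitz_low_coefs; rewrite char_poly_cascade -/p -/q.
rewrite !(coefB, coef0M, coef1M, coefD, coefX, coefC) /= -/s -/t -/d -/e.
set c0 := (X in X * _); set c1 := (X in _ * X).
have {}N0 : 0 < c0 by apply: etrans N0; congr (0 < _); rewrite /c0; ring.
have {}N1 : 0 < - c1 by apply: etrans N1; congr (0 < _); rewrite /c1; ring.
by rewrite pmulr_rgt0 // ltNge -oppr_ge0 ltW.
Qed.

(** Because the feedback is block diagonal, it merges with the diagonal blocks:
    the network is built from the standalone closed loops. *)
Lemma closed_loop_cascade (K : realType) (c1 c2 : converter K)
    (F1 F2 : 'M[K]_(1, 2)) (r : K) :
  closed_loop c1 c2 (block_mx F1 0 0 F2) r =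
  cascade_mx (standalone_A c1 + input_B c1 *m F1)
             (standalone_A c2 + input_B c2 *m F2)
             (duty c1 / inductance c1 * r) (duty c2 / inductance c2 * r).
Proof.
rewrite /closed_loop /network_B mulmx_block !mul0mx !mulmx0 !addr0 !add0r.
have -> : network_A c1 c2 r =
    cascade_mx (standalone_A c1) (standalone_A c2)
      (duty c1 / inductance c1 * r) (duty c2 / inductance c2 * r).
  case: c1 c2 => L1 C1 D1 V1 P1 [L2 C2 D2 V2 P2].
  apply/matrixP => i j; rewrite !mxE.
  by case: splitP => -[[|[|k]] // lt_k] ->; rewrite !mxE;
    case: splitP => -[[|[|l]] // lt_l] ->; rewrite !mxE /=; ring.
by rewrite add_block_mx !addr0 /cascade_mx !(addrAC _ (- _)).
Qed.

Theorem theorem1 (K : realType) (c1 c2 : converter K)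
    (hc1 : admissible c1) (hc2 : admissible c2)
    (F1 F2 : 'M[K]_(1, 2))
    (hF1 : individually_stabilized c1 F1)
    (hF2 : individually_stabilized c2 F2) :
  exists r : K, 0 < r /\ ~ hurwitz (closed_loop c1 c2 (block_mx F1 0 0 F2) r).
Proof.
have gt0 (c : converter K) (F : 'M[K]_(1, 2)) : admissible c ->
    0 < duty c / inductance c /\
    0 < (standalone_A c + input_B c *m F) 1 1.
  case: c => L C D V P [/= L0 C0 /andP[D0 _] V0 P0]; split.
    by rewrite divr_gt0.
  (* The second row of input_B vanishes, so F leaves the entry (1, 1) alone. *)
  rewrite !mxE big_ord1 !mxE /= mul0r addr0.
  by rewrite divr_gt0 // mulr_gt0 // exprn_gt0.
have [x0 p0] := gt0 c1 F1 hc1; have [y0 q0] := gt0 c2 F2 hc2.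
have [r r0 rP] := cascade_not_hurwitz x0 y0 p0 q0.
by exists r; rewrite closed_loop_cascade; split; [exact: r0|exact: rP].
Qed.
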